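(* Let $\mathcal{I}_{Lip}^{1},\mathcal{I}_{Lip}^{2}$ be normed Lipschitz operator ideals, let $X_1,X_2,Z,W$ be pointed metric spaces and $E,F$ Banach spaces, and let $f\in Lip_0(Z,X_1)$, $g\in Lip_0(W,X_2)$ and $u\in\mathcal{L}(E,F)$. If $T\in BLip(\mathcal{I}_{Lip}^{1},\mathcal{I}_{Lip}^{2})(X_1,X_2;E)$, then the composition $u\circ T\circ(f,g)$ is in $BLip(\mathcal{I}_{Lip}^{1},\mathcal{I}_{Lip}^{2})(Z,W;F)$ and $$\|u\circ T\circ(f,g)\|_{BLip(\mathcal{I}_{Lip}^{1},\mathcal{I}_{Lip}^{2})}\le\|u\|\,\|T\|_{BLip(\mathcal{I}_{Lip}^{1},\mathcal{I}_{Lip}^{2})}\,Lip(f)\,Lip(g).$$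
   Context: Let $\mathbb{K}$ be $\mathbb{R}$ or $\mathbb{C}$; all Banach spaces are over $\mathbb{K}$. A pointed metric space is a metric space with a distinguished base point $0$; a Banach space is a pointed metric space with base point the null vector. $Lip_0(X,Y)$ is the set of Lipschitz maps $T:X\to Y$ with $T(0)=0$ and $Lip(T)$ is the least Lipschitz constant; $X^{\#}=Lip_0(X,\mathbb{K})$. $\mathcal{L}(E,F)$ is the space of bounded linear operators. A map $T:X_1\times X_2\to E$ belongs to $BLip_0(X_1,X_2;E)$ if $T(x_1,0)=T(0,x_2)=0$ for all $x_1,x_2$ and there is $C>0$ with $\|T(x_1,x_2)-T(x_1,x_2')-T(x_1',x_2)+T(x_1',x_2')\|\le C\,d(x_1,x_1')d(x_2,x_2')$ for all $x_1,x_1'\in X_1$, $x_2,x_2'\in X_2$. The least such $C$ is the norm $BLip(T)$. A Lipschitz operator ideal $\mathcal{I}_{Lip}$ is a subclass of $Lip_0$ such that for every pointed metric space $X$ and Banach space $E$ the components $\mathcal{I}_{Lip}(X,E):=Lip_0(X,E)\cap\mathcal{I}_{Lip}$ satisfy: (i) $\mathcal{I}_{Lip}(X,E)$ is a linear subspace of $Lip_0(X,E)$; (ii) $vg:x\mapsto g(x)v$ belongs to $\mathcal{I}_{Lip}(X,E)$ for $v\in E$, $g\in X^{\#}$; (iii) if $S\in Lip_0(Y,X)$, $T\in\mathcal{I}_{Lip}(X,E)$, $w\in\mathcal{L}(E,F)$, then $wTS\in\mathcal{I}_{Lip}(Y,F)$. It is normed if there is $\|\cdot\|_{\mathcal{I}_{Lip}}:\mathcal{I}_{Lip}\to[0,\infty)$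 such that each $(\mathcal{I}_{Lip}(X,E),\|\cdot\|_{\mathcal{I}_{Lip}})$ is a normed space with $Lip(T)\le\|T\|_{\mathcal{I}_{Lip}}$; $\|Id_{\mathbb{K}}\|_{\mathcal{I}_{Lip}}=1$; and $\|wTS\|_{\mathcal{I}_{Lip}}\le Lip(S)\|T\|_{\mathcal{I}_{Lip}}\|w\|$. Factorization method: $T\in BLip_0(X_1,X_2;E)$ belongs to $BLip(\mathcal{I}_{Lip}^{1},\mathcal{I}_{Lip}^{2})(X_1,X_2;E)$ iff there are Banach spaces $G_1,G_2$, $f_j\in\mathcal{I}_{Lip}^{j}(X_j,G_j)$ ($j=1,2$) and $R\in BLip_0(G_1,G_2;E)$ with $T=R\circ(f_1,f_2)$; and $\|T\|_{BLip(\mathcal{I}_{Lip}^{1},\mathcal{I}_{Lip}^{2})}=\inf BLip(R)\|f_1\|_{\mathcal{I}_{Lip}^{1}}\|f_2\|_{\mathcal{I}_{Lip}^{2}}$, the infimum over all such factorizations. *)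

(* Defs.v *)
From Stdlib Require Import Reals.
From Coquelicot Require Import Coquelicot.

Open Scope R_scope.

Inductive scalars : Set := RealScalars | ComplexScalars.

Definition field_of (k : scalars) : AbsRing :=
  match k with RealScalars => R_AbsRing | ComplexScalars => C_AbsRing end.

Notation Banach k := (CompleteNormedModule (field_of k)).

(* The match is on the class only, so that the carrier of [scalar_banach k] is
   convertible to [field_of k] for a variable [k]. *)
Definition scalar_banach (k : scalars) : Banach k :=
  CompleteNormedModule.Pack (field_of k) (field_of k)
    match k return CompleteNormedModule.class_of (field_of k) (field_of k) with
    | RealScalars => CompleteNormedModule.class _ R_CompleteNormedModule
    | ComplexScalars => CompleteNormedModule.class _ C_CompleteNormedModule
    end
    (field_of k).

Record PointedMetric : Type := {
  pm_space : Metric_Space;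
  pm_base : Base pm_space
}.

Definition pm_carrier (X : PointedMetric) : Type := Base (pm_space X).
Coercion pm_carrier : PointedMetric >-> Sortclass.

Definition pm_dist (X : PointedMetric) : X -> X -> R := dist (pm_space X).

Arguments pm_base {_}.
Arguments pm_dist {_} _ _.

Section BanachPointedMetric.

Context {k : scalars} (E : Banach k).

Definition banach_dist (x y : E) : R := norm (minus x y).

Fact banach_dist_pos (x y : E) : banach_dist x y >= 0.
Proof. apply Rle_ge, norm_ge_0. Qed.

Fact banach_dist_sym (x y : E) : banach_dist x y = banach_dist y x.
Proof. unfold banach_dist; rewrite <- norm_opp, opp_minus; reflexivity. Qed.

Fact banach_dist_refl (x y : E) : banach_dist x y = 0 <-> x = y.
Proof.
  unfold banach_dist; split; intro H.
  - apply norm_eq_zero in H.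
    apply (plus_reg_r (opp y)). rewrite plus_opp_r. exact H.
  - rewrite H, minus_eq_zero. apply (@norm_zero _ E).
Qed.

Fact banach_dist_tri (x y z : E) : banach_dist x y <= banach_dist x z + banach_dist z y.
Proof.
  unfold banach_dist. rewrite (minus_trans z x y). exact (@norm_triangle _ E (minus x z) (minus z y)).
Qed.

Definition banach_metric : Metric_Space :=
  Build_Metric_Space E banach_dist
    banach_dist_pos banach_dist_sym banach_dist_refl banach_dist_tri.

Definition banach_pm : PointedMetric :=
  {| pm_space := banach_metric; pm_base := (zero : E) |}.

End BanachPointedMetric.

Definition lip_bound (X Y : PointedMetric) (T : X -> Y) (C : R) : Prop :=
  forall x x' : X, pm_dist (T x) (T x') <= C * pm_dist x x'.

Definition Lip0 (X Y : PointedMetric) (T : X -> Y) : Prop :=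
  T pm_base = pm_base /\ exists C : R, 0 <= C /\ lip_bound X Y T C.

(* [0 <= C] matters when [X] is a single point: every real is then a bound. *)
Definition Lip (X Y : PointedMetric) (T : X -> Y) : R :=
  real (Glb_Rbar (fun C => 0 <= C /\ lip_bound X Y T C)).

Definition opnorm {k : scalars} {E F : Banach k} (u : E -> F) : R :=
  real (Lub_Rbar (fun r => exists x : E, norm x <= 1 /\ r = norm (u x))).

Definition blip_bound {k : scalars} (X1 X2 : PointedMetric) (E : Banach k)
    (T : X1 -> X2 -> E) (C : R) : Prop :=
  forall (x1 x1' : X1) (x2 x2' : X2),
    norm (plus (minus (minus (T x1 x2) (T x1 x2')) (T x1' x2)) (T x1' x2'))
      <= C * pm_dist x1 x1' * pm_dist x2 x2'.

Definition BLip0 {k : scalars} (X1 X2 : PointedMetric) (E : Banach k)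
    (T : X1 -> X2 -> E) : Prop :=
  (forall x1 : X1, T x1 pm_base = zero) /\
  (forall x2 : X2, T pm_base x2 = zero) /\
  exists C : R, 0 < C /\ blip_bound X1 X2 E T C.

Definition BLip {k : scalars} (X1 X2 : PointedMetric) (E : Banach k)
    (T : X1 -> X2 -> E) : R :=
  real (Glb_Rbar (fun C => 0 <= C /\ blip_bound X1 X2 E T C)).

(* In the two records below, bounded linear operators are Coquelicot's
   [is_linear] maps, whose definition includes boundedness. *)

Record LipIdeal (k : scalars) : Type := {
  ideal_mem : forall (X : PointedMetric) (E : Banach k), (X -> E) -> Prop;
  ideal_Lip0 : forall (X : PointedMetric) (E : Banach k) (T : X -> E),
    ideal_mem X E T -> Lip0 X (banach_pm E) T;
  ideal_zero : forall (X : PointedMetric) (E : Banach k),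
    ideal_mem X E (fun _ => zero);
  ideal_plus : forall (X : PointedMetric) (E : Banach k) (T T' : X -> E),
    ideal_mem X E T -> ideal_mem X E T' ->
    ideal_mem X E (fun x => plus (T x) (T' x));
  ideal_scal : forall (X : PointedMetric) (E : Banach k)
      (a : field_of k) (T : X -> E),
    ideal_mem X E T -> ideal_mem X E (fun x => scal a (T x));
  ideal_rank_one : forall (X : PointedMetric) (E : Banach k)
      (v : E) (g : X -> field_of k),
    Lip0 X (banach_pm (scalar_banach k)) g ->
    ideal_mem X E (fun x => scal (g x) v);
  ideal_comp : forall (X Y : PointedMetric) (E F : Banach k)
      (S : Y -> X) (T : X -> E) (w : E -> F),
    Lip0 Y X S -> ideal_mem X E T -> is_linear w ->
    ideal_mem Y F (fun y => w (T (S y)))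
}.

Arguments ideal_mem {_} _ _ _ _.

Record NormedLipIdeal (k : scalars) : Type := {
  nideal :> LipIdeal k;
  ideal_norm : forall (X : PointedMetric) (E : Banach k), (X -> E) -> R;
  ideal_norm_ge0 : forall (X : PointedMetric) (E : Banach k) (T : X -> E),
    ideal_mem nideal X E T -> 0 <= ideal_norm X E T;
  ideal_norm_eq0 : forall (X : PointedMetric) (E : Banach k) (T : X -> E),
    ideal_mem nideal X E T -> ideal_norm X E T = 0 -> forall x, T x = zero;
  ideal_norm_scal : forall (X : PointedMetric) (E : Banach k)
      (a : field_of k) (T : X -> E),
    ideal_mem nideal X E T ->
    ideal_norm X E (fun x => scal a (T x)) = abs a * ideal_norm X E T;
  ideal_norm_triangle : forall (X : PointedMetric) (E : Banach k)
      (T T' : X -> E),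
    ideal_mem nideal X E T -> ideal_mem nideal X E T' ->
    ideal_norm X E (fun x => plus (T x) (T' x))
      <= ideal_norm X E T + ideal_norm X E T';
  ideal_norm_Lip : forall (X : PointedMetric) (E : Banach k) (T : X -> E),
    ideal_mem nideal X E T -> Lip X (banach_pm E) T <= ideal_norm X E T;
  ideal_norm_id :
    ideal_norm (banach_pm (scalar_banach k)) (scalar_banach k)
      (fun a => a) = 1;
  ideal_norm_comp : forall (X Y : PointedMetric) (E F : Banach k)
      (S : Y -> X) (T : X -> E) (w : E -> F),
    Lip0 Y X S -> ideal_mem nideal X E T -> is_linear w ->
    ideal_norm Y F (fun y => w (T (S y)))
      <= Lip Y X S * ideal_norm X E T * opnorm w
}.

Arguments ideal_norm {_} _ _ _ _.

Section Factorization.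

Context {k : scalars} (I1 I2 : NormedLipIdeal k).
Context (X1 X2 : PointedMetric) (E : Banach k).

Definition factors (T : X1 -> X2 -> E) (G1 G2 : Banach k)
    (f1 : X1 -> G1) (f2 : X2 -> G2) (B : G1 -> G2 -> E) : Prop :=
  ideal_mem I1 X1 G1 f1 /\ ideal_mem I2 X2 G2 f2 /\
  BLip0 (banach_pm G1) (banach_pm G2) E B /\
  forall (x1 : X1) (x2 : X2), T x1 x2 = B (f1 x1) (f2 x2).

Definition fact_mem (T : X1 -> X2 -> E) : Prop :=
  BLip0 X1 X2 E T /\
  exists (G1 G2 : Banach k) (f1 : X1 -> G1) (f2 : X2 -> G2)
    (B : G1 -> G2 -> E), factors T G1 G2 f1 f2 B.

Definition fact_norm (T : X1 -> X2 -> E) : R :=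
  real (Glb_Rbar (fun r =>
    exists (G1 G2 : Banach k) (f1 : X1 -> G1) (f2 : X2 -> G2)
      (B : G1 -> G2 -> E),
      factors T G1 G2 f1 f2 B /\
      r = BLip (banach_pm G1) (banach_pm G2) E B
          * ideal_norm I1 X1 G1 f1 * ideal_norm I2 X2 G2 f2)).

End Factorization.

(* Main.v *)
Require Import Defs.
From Stdlib Require Import Reals Lra.
From Coquelicot Require Import Coquelicot.

Open Scope R_scope.

(** If [T = B o (f1, f2)], then [u o T o (f, g)] factors as
    [(u o B) o (f1 o f, f2 o g)] through the same Banach spaces.  The ideal
    property puts [f1 o f] and [f2 o g] back into the two ideals, with norms at
    most [Lip f * |f1|] and [Lip g * |f2|]; composing on the left with the
    operator [u] costs at most a factor [opnorm u] in [BLip B].  So every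
    factorization of [T] with cost [r] produces one of [u o T o (f, g)] with
    cost at most [opnorm u * r * Lip f * Lip g] ([factors_comp]), and taking
    the infimum over [r] gives the inequality.

    The suprema and infima are real projections of extended reals, so before
    they can be used they must be shown finite.  The infima here are over
    nonempty sets of nonnegative reals ([real_Glb_le], [real_Glb_scal]), and
    the supremum defining [opnorm u] is finite because [u] is bounded
    ([norm_le_opnorm_unit_ball]). *)

(** * Infima of nonnegative reals *)

Lemma real_Glb_le (S : R -> Prop) (x : R) :
  (forall y, S y -> 0 <= y) -> S x -> real (Glb_Rbar S) <= x.
Proof.
  intros S_ge0 Sx.
  destruct (Glb_Rbar_correct S) as [lower greatest].
  assert (le_x := lower x Sx).
  assert (ge_0 : Rbar_le 0 (Glb_Rbar S)) by (apply greatest; exact S_ge0).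
  destruct (Glb_Rbar S); simpl in *; tauto.
Qed.

Lemma real_Glb_ge0 (S : R -> Prop) :
  (forall y, S y -> 0 <= y) -> 0 <= real (Glb_Rbar S).
Proof.
  intros S_ge0.
  destruct (Glb_Rbar_correct S) as [_ greatest].
  assert (ge_0 : Rbar_le 0 (Glb_Rbar S)) by (apply greatest; exact S_ge0).
  destruct (Glb_Rbar S); simpl in *; lra.
Qed.

(** Multiplication by [c >= 0] passes through an infimum.  Nonemptiness is what
    excludes the value [+oo], whose real projection is [0]. *)
Lemma real_Glb_scal (S : R -> Prop) (c m : R) :
  0 <= c -> (exists x, S x) -> (forall x, S x -> 0 <= x) ->
  (forall x, S x -> m <= c * x) -> m <= c * real (Glb_Rbar S).
Proof.
  intros c_ge0 [x0 Sx0] S_ge0 m_le.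
  destruct (Req_dec c 0) as [-> | c_neq0].
  - specialize (m_le x0 Sx0); lra.
  - assert (c_gt0 : 0 < c) by lra.
    assert (ge_m : Rbar_le (m / c) (Glb_Rbar S)).
    { apply (proj2 (Glb_Rbar_correct S)); intros x Sx; simpl.
      apply Rle_div_l; [exact c_gt0 |].
      rewrite Rmult_comm; auto. }
    assert (le_x0 := proj1 (Glb_Rbar_correct S) x0 Sx0).
    assert (ge_0 : Rbar_le 0 (Glb_Rbar S))
      by (apply (proj2 (Glb_Rbar_correct S)); exact S_ge0).
    destruct (Glb_Rbar S); simpl in *; try tauto.
    apply Rle_div_l in ge_m; lra.
Qed.

Lemma pm_dist_ge0 (X : PointedMetric) (x y : X) : 0 <= pm_dist x y.
Proof. apply Rge_le, dist_pos. Qed.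

Lemma Lip_ge0 (X Y : PointedMetric) (T : X -> Y) : 0 <= Lip X Y T.
Proof. apply real_Glb_ge0; tauto. Qed.

(** * The operator norm *)

Lemma exists_scalar_inverse_pair (k : scalars) (r : R) :
  0 < r -> exists a b : field_of k, mult b a = one /\ abs a = / r /\ abs b = r.
Proof.
  intros r_gt0.
  assert (inv_gt0 := Rinv_0_lt_compat r r_gt0).
  destruct k; simpl.
  - exists (/ r), r; repeat split; unfold mult, one, abs; simpl.
    + apply Rinv_r; lra.
    + apply Rabs_pos_eq; lra.
    + apply Rabs_pos_eq; lra.
  - exists (RtoC (/ r)), (RtoC r); repeat split.
    + change (Cmult (RtoC r) (RtoC (/ r)) = RtoC 1).
      rewrite <- RtoC_mult; f_equal; apply Rinv_r; lra.
    + change (Cmod (RtoC (/ r)) = / r).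
      rewrite Cmod_R; apply Rabs_pos_eq; lra.
    + change (Cmod (RtoC r) = r).
      rewrite Cmod_R; apply Rabs_pos_eq; lra.
Qed.

Section OperatorNorm.

Context {k : scalars} {E F : Banach k} (u : E -> F).

Context (u_linear : is_linear u).

Lemma norm_le_opnorm_unit_ball (x : E) : norm x <= 1 -> norm (u x) <= opnorm u.
Proof.
  intros x_le1; unfold opnorm.
  destruct (linear_norm u u_linear) as [M [M_gt0 u_le]].
  set (values := fun r => _).
  destruct (Lub_Rbar_correct values) as [upper least].
  assert (ge_x : Rbar_le (norm (u x)) (Lub_Rbar values))
    by (apply upper; exists x; auto).
  assert (le_M : Rbar_le (Lub_Rbar values) M).
  { apply least; intros r [y [y_le1 ->]]; simpl.
    apply Rle_trans with (1 := u_le y).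
    assert (0 <= norm y) by apply norm_ge_0; nra. }
  destruct (Lub_Rbar values); simpl in *; tauto.
Qed.

Lemma opnorm_ge0 : 0 <= opnorm u.
Proof.
  apply Rle_trans with (norm (u zero)); [apply norm_ge_0 |].
  apply norm_le_opnorm_unit_ball.
  apply Rle_trans with 0; [apply Req_le, (@norm_zero _ E) | lra].
Qed.

(** Homogeneity reduces this to the unit ball.  Norms over an [AbsRing] are only
    submultiplicative for scalars, so the rescaled vector is scaled back by the
    inverse scalar. *)
Lemma norm_le_opnorm (x : E) : norm (u x) <= opnorm u * norm x.
Proof.
  destruct (Req_dec (norm x) 0) as [x_eq0 | x_neq0].
  - apply norm_eq_zero in x_eq0; rewrite x_eq0.
    rewrite (linear_zero u u_linear).
    apply Rle_trans with 0; [apply Req_le, (@norm_zero _ F) |].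
    apply Rmult_le_pos; [now apply opnorm_ge0 | apply norm_ge_0].
  - assert (x_gt0 : 0 < norm x)
      by (assert (0 <= norm x) by apply norm_ge_0; lra).
    destruct (exists_scalar_inverse_pair k (norm x) x_gt0)
      as [a [b [ba_eq1 [abs_a abs_b]]]].
    assert (ax_le1 : norm (scal a x) <= 1).
    { apply Rle_trans with (1 := norm_scal a x).
      rewrite abs_a, Rinv_l; lra. }
    replace (u x) with (scal b (u (scal a x))).
    + apply Rle_trans with (1 := @norm_scal _ F b _).
      rewrite abs_b, Rmult_comm.
      apply Rmult_le_compat_r; [lra |].
      now apply norm_le_opnorm_unit_ball.
    + rewrite (linear_scal u u_linear), scal_assoc, ba_eq1.
      apply (@scal_one _ F).
Qed.

End OperatorNorm.

(** Only an inequality, since the identity of the null space has norm [0]. *)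
Lemma opnorm_id_le1 {k : scalars} (E : Banach k) : opnorm (fun x : E => x) <= 1.
Proof.
  unfold opnorm; set (values := fun r => _).
  assert (le_1 : Rbar_le (Lub_Rbar values) 1).
  { apply (proj2 (Lub_Rbar_correct values)).
    intros r [y [y_le1 ->]]; exact y_le1. }
  destruct (Lub_Rbar values); simpl in *; lra.
Qed.

(** * Two-Lipschitz maps *)

Lemma blip_bound_comp_linear {k : scalars} (X1 X2 : PointedMetric)
    (E F : Banach k) (u : E -> F) (T : X1 -> X2 -> E) (C : R) :
  is_linear u -> blip_bound X1 X2 E T C ->
  blip_bound X1 X2 F (fun x1 x2 => u (T x1 x2)) (opnorm u * C).
Proof.
  intros u_linear T_le x1 x1' x2 x2'.
  unfold minus.
  rewrite <- !(linear_opp u _ u_linear), <- !(linear_plus u u_linear).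
  apply Rle_trans with (1 := norm_le_opnorm u u_linear _).
  rewrite !Rmult_assoc; apply Rmult_le_compat_l.
  - now apply opnorm_ge0.
  - rewrite <- Rmult_assoc; apply T_le.
Qed.

Lemma blip_bound_precomp {k : scalars} (X1 X2 Z W : PointedMetric)
    (E : Banach k) (f : Z -> X1) (g : W -> X2) (T : X1 -> X2 -> E)
    (C Cf Cg : R) :
  0 <= C -> 0 <= Cf -> lip_bound Z X1 f Cf -> lip_bound W X2 g Cg ->
  blip_bound X1 X2 E T C ->
  blip_bound Z W E (fun z w => T (f z) (g w)) (C * Cf * Cg).
Proof.
  intros C_ge0 Cf_ge0 f_le g_le T_le z z' w w'.
  apply Rle_trans with (1 := T_le _ _ _ _).
  replace (C * Cf * Cg * pm_dist z z' * pm_dist w w')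
    with (C * (Cf * pm_dist z z') * (Cg * pm_dist w w')) by ring.
  apply Rmult_le_compat.
  - apply Rmult_le_pos; [exact C_ge0 | apply pm_dist_ge0].
  - apply pm_dist_ge0.
  - apply Rmult_le_compat_l; [exact C_ge0 | apply f_le].
  - apply g_le.
Qed.

(** [BLip0] asks for a positive constant, and composing with constant maps or
    with the null operator yields the constant [0]. *)
Lemma blip_bound_positive {k : scalars} (X1 X2 : PointedMetric) (E : Banach k)
    (T : X1 -> X2 -> E) (C : R) :
  0 <= C -> blip_bound X1 X2 E T C ->
  exists C' : R, 0 < C' /\ blip_bound X1 X2 E T C'.
Proof.
  intros C_ge0 T_le; exists (C + 1); split; [lra |].
  intros x1 x1' x2 x2'.
  apply Rle_trans with (1 := T_le _ _ _ _).
  apply Rmult_le_compat_r; [apply pm_dist_ge0 |].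
  apply Rmult_le_compat_r; [apply pm_dist_ge0 | lra].
Qed.

Lemma BLip0_comp_linear {k : scalars} (X1 X2 : PointedMetric) (E F : Banach k)
    (u : E -> F) (T : X1 -> X2 -> E) :
  is_linear u -> BLip0 X1 X2 E T -> BLip0 X1 X2 F (fun x1 x2 => u (T x1 x2)).
Proof.
  intros u_linear [T0r [T0l [C [C_gt0 T_le]]]]; repeat split.
  - intros x1; rewrite T0r; exact (linear_zero u u_linear).
  - intros x2; rewrite T0l; exact (linear_zero u u_linear).
  - apply (blip_bound_positive _ _ _ _ (opnorm u * C)).
    + apply Rmult_le_pos; [now apply opnorm_ge0 | lra].
    + now apply blip_bound_comp_linear.
Qed.

Lemma BLip0_precomp {k : scalars} (X1 X2 Z W : PointedMetric) (E : Banach k)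
    (f : Z -> X1) (g : W -> X2) (T : X1 -> X2 -> E) :
  Lip0 Z X1 f -> Lip0 W X2 g -> BLip0 X1 X2 E T ->
  BLip0 Z W E (fun z w => T (f z) (g w)).
Proof.
  intros [f0 [Cf [Cf_ge0 f_le]]] [g0 [Cg [Cg_ge0 g_le]]]
    [T0r [T0l [C [C_gt0 T_le]]]]; repeat split.
  - intros z; rewrite g0; apply T0r.
  - intros w; rewrite f0; apply T0l.
  - apply (blip_bound_positive _ _ _ _ (C * Cf * Cg)).
    + repeat apply Rmult_le_pos; lra.
    + apply blip_bound_precomp; auto; lra.
Qed.

Lemma BLip_ge0 {k : scalars} (X1 X2 : PointedMetric) (E : Banach k)
    (T : X1 -> X2 -> E) : 0 <= BLip X1 X2 E T.
Proof. apply real_Glb_ge0; tauto. Qed.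

Lemma BLip_comp_linear_le {k : scalars} (X1 X2 : PointedMetric) (E F : Banach k)
    (u : E -> F) (T : X1 -> X2 -> E) :
  is_linear u -> BLip0 X1 X2 E T ->
  BLip X1 X2 F (fun x1 x2 => u (T x1 x2)) <= opnorm u * BLip X1 X2 E T.
Proof.
  intros u_linear [_ [_ [C0 [C0_gt0 T_le0]]]].
  assert (u_ge0 := opnorm_ge0 u u_linear).
  apply real_Glb_scal.
  - exact u_ge0.
  - exists C0; split; [lra | exact T_le0].
  - tauto.
  - intros C [C_ge0 T_le]; apply real_Glb_le; [tauto |].
    split; [now apply Rmult_le_pos | now apply blip_bound_comp_linear].
Qed.

(** * Factorizations *)

Lemma is_linear_id {k : scalars} (E : Banach k) : is_linear (fun x : E => x).
Proof. exact (@is_linear_id _ E). Qed.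

(** The ideal property with the identity as left operator. *)
Lemma ideal_mem_precomp {k : scalars} (I : LipIdeal k) (X Z : PointedMetric)
    (G : Banach k) (h : X -> G) (f : Z -> X) :
  Lip0 Z X f -> ideal_mem I X G h -> ideal_mem I Z G (fun z => h (f z)).
Proof.
  intros f_lip h_mem.
  exact (ideal_comp k I X Z G G f h (fun x => x) f_lip h_mem (is_linear_id G)).
Qed.

Lemma ideal_norm_precomp_le {k : scalars} (I : NormedLipIdeal k)
    (X Z : PointedMetric) (G : Banach k) (h : X -> G) (f : Z -> X) :
  Lip0 Z X f -> ideal_mem I X G h ->
  ideal_norm I Z G (fun z => h (f z)) <= Lip Z X f * ideal_norm I X G h.
Proof.
  intros f_lip h_mem.
  apply Rle_trans with
    (1 := ideal_norm_comp k I X Z G G f h (fun x => x) f_lip h_mem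
            (is_linear_id G)).
  rewrite <- (Rmult_1_r (Lip Z X f * _)) at 2.
  apply Rmult_le_compat_l; [| apply opnorm_id_le1].
  apply Rmult_le_pos; [apply Lip_ge0 | now apply ideal_norm_ge0].
Qed.

Section Composition.

Context {k : scalars} (I1 I2 : NormedLipIdeal k).

Lemma factorization_cost_ge0 (X1 X2 : PointedMetric) (E G1 G2 : Banach k)
    (T : X1 -> X2 -> E) (f1 : X1 -> G1) (f2 : X2 -> G2) (B : G1 -> G2 -> E) :
  factors I1 I2 X1 X2 E T G1 G2 f1 f2 B ->
  0 <= BLip (banach_pm G1) (banach_pm G2) E B
       * ideal_norm I1 X1 G1 f1 * ideal_norm I2 X2 G2 f2.
Proof.
  intros [f1_mem [f2_mem _]].
  repeat apply Rmult_le_pos;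
    [apply BLip_ge0 | now apply ideal_norm_ge0 | now apply ideal_norm_ge0].
Qed.

Lemma fact_norm_le (X1 X2 : PointedMetric) (E G1 G2 : Banach k)
    (T : X1 -> X2 -> E) (f1 : X1 -> G1) (f2 : X2 -> G2) (B : G1 -> G2 -> E) :
  factors I1 I2 X1 X2 E T G1 G2 f1 f2 B ->
  fact_norm I1 I2 X1 X2 E T
    <= BLip (banach_pm G1) (banach_pm G2) E B
       * ideal_norm I1 X1 G1 f1 * ideal_norm I2 X2 G2 f2.
Proof.
  intros T_fact; apply real_Glb_le.
  - intros r [H1 [H2 [h1 [h2 [D [D_fact ->]]]]]].
    now apply factorization_cost_ge0 with (1 := D_fact).
  - now exists G1, G2, f1, f2, B.
Qed.

Context (X1 X2 Z W : PointedMetric) (E F : Banach k).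
Context (f : Z -> X1) (g : W -> X2) (u : E -> F) (T : X1 -> X2 -> E).
Context (f_lip : Lip0 Z X1 f) (g_lip : Lip0 W X2 g) (u_linear : is_linear u).

(** The inner maps absorb [f] and [g], and the outer two-Lipschitz map absorbs
    [u]. *)
Lemma factors_comp (G1 G2 : Banach k) (f1 : X1 -> G1) (f2 : X2 -> G2)
    (B : G1 -> G2 -> E) :
  factors I1 I2 X1 X2 E T G1 G2 f1 f2 B ->
  factors I1 I2 Z W F (fun z w => u (T (f z) (g w))) G1 G2
    (fun z => f1 (f z)) (fun w => f2 (g w)) (fun y1 y2 => u (B y1 y2)).
Proof.
  intros [f1_mem [f2_mem [B_blip T_eq]]].
  refine (conj _ (conj _ (conj _ _))).
  - now apply ideal_mem_precomp.
  - now apply ideal_mem_precomp.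
  - now apply BLip0_comp_linear.
  - intros z w; now rewrite T_eq.
Qed.

Lemma fact_mem_comp :
  fact_mem I1 I2 X1 X2 E T ->
  fact_mem I1 I2 Z W F (fun z w => u (T (f z) (g w))).
Proof.
  intros [T_blip [G1 [G2 [f1 [f2 [B T_fact]]]]]]; split.
  - apply (BLip0_comp_linear Z W E F u (fun z w => T (f z) (g w))).
    + exact u_linear.
    + now apply BLip0_precomp.
  - exists G1, G2, (fun z => f1 (f z)), (fun w => f2 (g w)),
      (fun y1 y2 => u (B y1 y2)).
    now apply factors_comp.
Qed.

Lemma fact_norm_comp_le :
  fact_mem I1 I2 X1 X2 E T ->
  fact_norm I1 I2 Z W F (fun z w => u (T (f z) (g w)))
    <= opnorm u * Lip Z X1 f * Lip W X2 g * fact_norm I1 I2 X1 X2 E T.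
Proof.
  intros [_ [G1 [G2 [f1 [f2 [B T_fact]]]]]].
  assert (u_ge0 := opnorm_ge0 u u_linear).
  assert (f_ge0 := Lip_ge0 _ _ f); assert (g_ge0 := Lip_ge0 _ _ g).
  apply real_Glb_scal.
  - repeat apply Rmult_le_pos; assumption.
  - now exists (BLip (banach_pm G1) (banach_pm G2) E B
                * ideal_norm I1 X1 G1 f1 * ideal_norm I2 X2 G2 f2),
      G1, G2, f1, f2, B.
  - intros r [H1 [H2 [h1 [h2 [D [D_fact ->]]]]]].
    now apply factorization_cost_ge0 with (1 := D_fact).
  - intros r [H1 [H2 [h1 [h2 [D [D_fact ->]]]]]].
    apply Rle_trans with
      (1 := fact_norm_le _ _ _ _ _ _ _ _ _ (factors_comp _ _ _ _ _ D_fact)).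
    destruct (factors_comp _ _ _ _ _ D_fact) as [h1f_mem [h2g_mem _]].
    destruct D_fact as [h1_mem [h2_mem [D_blip _]]].
    replace (opnorm u * Lip Z X1 f * Lip W X2 g * _)
      with (opnorm u * BLip (banach_pm H1) (banach_pm H2) E D
            * (Lip Z X1 f * ideal_norm I1 X1 H1 h1)
            * (Lip W X2 g * ideal_norm I2 X2 H2 h2)) by ring.
    apply Rmult_le_compat.
    + apply Rmult_le_pos; [apply BLip_ge0 | now apply ideal_norm_ge0].
    + now apply ideal_norm_ge0.
    + apply Rmult_le_compat.
      * apply BLip_ge0.
      * now apply ideal_norm_ge0.
      * now apply BLip_comp_linear_le.
      * now apply ideal_norm_precomp_le.
    + now apply ideal_norm_precomp_le.
Qed.

End Composition.

Theorem proposition5p12 (k : scalars) (I1 I2 : NormedLipIdeal k)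
    (X1 X2 Z W : PointedMetric) (E F : Banach k)
    (f : Z -> X1) (g : W -> X2) (u : E -> F)
    (hf : Lip0 Z X1 f) (hg : Lip0 W X2 g) (hu : is_linear u)
    (T : X1 -> X2 -> E) (hT : fact_mem I1 I2 X1 X2 E T) :
  fact_mem I1 I2 Z W F (fun z w => u (T (f z) (g w))) /\
  fact_norm I1 I2 Z W F (fun z w => u (T (f z) (g w)))
    <= opnorm u * fact_norm I1 I2 X1 X2 E T * Lip Z X1 f * Lip W X2 g.
Proof.
  split.
  - now apply fact_mem_comp.
  - replace (opnorm u * fact_norm I1 I2 X1 X2 E T * Lip Z X1 f * Lip W X2 g)
      with (opnorm u * Lip Z X1 f * Lip W X2 g * fact_norm I1 I2 X1 X2 E T)
      by ring.
    now apply fact_norm_comp_le.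
Qed.
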